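(* For every integer $n\ge 0$, the Hankel transform $(h_n)_{n\ge 0}$ of the sequence $(C_{n+2}+C_{n+3})_{n\ge 0}$ is given by $$h_n=[x^{n+1}]\,\frac{1+x}{1-6x+11x^2-6x^3+x^4}.$$
   Context: $C_n=\frac{1}{n+1}\binom{2n}{n}$ denotes the $n$-th Catalan number ($1,1,2,5,14,\ldots$). The Hankel transform of a sequence $(s_n)_{n\ge 0}$ is the sequence $(h_n)_{n\ge 0}$ with $h_n=\det(s_{i+j})_{0\le i,j\le n}$. $[x^m]F(x)$ denotes the coefficient of $x^m$ in the formal power series $F(x)$. *)

(* Defs.v *)
From mathcomp Require Import all_boot all_order all_algebra.

Set Implicit Arguments.
Unset Strict Implicit.
Unset Printing Implicit Defensive.

Import GRing.Theory.
Local Open Scope ring_scope.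

(* The truncated division is exact, see catalanE. *)
Definition catalan (n : nat) : nat := ('C(2 * n, n) %/ n.+1)%N.

Lemma catalanE (n : nat) : (n.+1 * catalan n = 'C(2 * n, n))%N.
Proof.
rewrite mulnC divnK //.
have h : (n.+1 * 'C(2 * n, n.+1) = n * 'C(2 * n, n))%N.
  by rewrite mul_bin_left mul2n -addnn addnK.
rewrite -(@Gauss_dvdr _ n) ?coprimeSn //.
by rewrite -h dvdn_mulr.
Qed.

Definition hankel_transform (R : comPzRingType) (s : nat -> R) (n : nat) : R :=
  \det (\matrix_(i < n.+1, j < n.+1) s (i + j)%N).

(* A formal power series is its sequence of coefficients. *)
Definition fps (R : Type) : Type := nat -> R.

Definition coef_fps (R : Type) (m : nat) (f : fps R) : R := f m.

Definition fps_of_poly (R : nzRingType) (p : {poly R}) : fps R := fun n => p`_n.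

Definition fps_mul (R : pzRingType) (f g : fps R) : fps R :=
  fun n => \sum_(i < n.+1) f i * g (n - i)%N.

(* [fps_inv_take f n] lists the first n coefficients of 1/f, computed by
   solving f * (1/f) = 1 one degree at a time; meaningful when f 0 is a unit, see fps_mulV. *)
Fixpoint fps_inv_take (R : comUnitRingType) (f : fps R) (n : nat) : seq R :=
  if n is m.+1 then
    let s := fps_inv_take f m in
    rcons s ((f 0%N)^-1 * ((m == 0%N)%:R - \sum_(i < m) f i.+1 * s`_(m - i.+1)))
  else [::].

Definition fps_inv (R : comUnitRingType) (f : fps R) : fps R :=
  fun n => (fps_inv_take f n.+1)`_n.

Definition fps_div (R : comUnitRingType) (f g : fps R) : fps R :=
  fps_mul f (fps_inv g).

Lemma size_fps_inv_take (R : comUnitRingType) (f : fps R) n :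
  size (fps_inv_take f n) = n.
Proof. by elim: n => //= n IHn; rewrite size_rcons IHn. Qed.

Lemma nth_fps_inv_take (R : comUnitRingType) (f : fps R) n i :
  (i < n)%N -> (fps_inv_take f n)`_i = fps_inv f i.
Proof.
elim: n => // n IHn; rewrite ltnS leq_eqVlt => /orP[/eqP -> //|lt_in].
by rewrite /= nth_rcons size_fps_inv_take lt_in IHn.
Qed.

Lemma fps_mulV (R : comUnitRingType) (f : fps R) (n : nat) :
  f 0%N \is a GRing.unit -> fps_mul f (fps_inv f) n = (n == 0%N)%:R.
Proof.
move=> Uf; rewrite /fps_mul big_ord_recl /= subn0 {1}/fps_inv /=.
rewrite nth_rcons size_fps_inv_take ltnn eqxx mulVKr //.
rewrite -[RHS]addr0 -addrA; congr (_ + _); apply/eqP; rewrite addrC subr_eq0.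
apply/eqP/eq_bigr => i _; rewrite /bump /= add1n nth_fps_inv_take //.
by rewrite ltn_subrL (leq_trans _ (ltn_ord i)).
Qed.

(* Main.v *)
Require Import Defs.
From mathcomp Require Import all_boot all_order all_algebra.
From mathcomp Require Import zify ring.
Set Implicit Arguments.
Unset Strict Implicit.
Unset Printing Implicit Defensive.
Import GRing.Theory.
Local Open Scope ring_scope.

(** Write [T a] for the infinite tridiagonal matrix with [a] on the diagonal and
1 next to it.  The shifted Catalan numbers [C_(m+1)] count weighted walks on
the naturals governed by [T 2]: if [ballot n k] is the weight of the walks of
length [n] from 0 to [k], then splitting a walk of length [i + j] at time [i]
gives [C_(i+j+1) = \sum_k ballot i k * ballot j k] ([sum_ballot_mul]).  Taking
one more step on the left, and one more step or none on the right, gives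
[[
  C_(i+j+2) + C_(i+j+3) = (L * T 2 * T 3 * L^T)_(i,j),   L = (ballot i k),
]]
because [T 2 + 1 = T 3].  As [L] is unitriangular, the Hankel determinant is the
leading minor of order [n + 1] of the pentadiagonal matrix [T 2 * T 3]; the
inner index there has to run one step further than the outer ones.

The leading minor of [T a * T b] of order [n] is
[\sum_(k <= n) p_k(a) p_k(b)], with [p_k(a)] the leading minor of [T a] of order
[k] ([det_tridiag_mul]): a form of the Christoffel-Darboux kernel.
Indeed it differs from the product of the truncations of [T a] and
[T b] only in the bottom right corner, where 1 is added, and adding 1 to that
corner adds to the determinant the same minor of order one less.

Here [p_k(2) = k + 1], and [q_k = p_k(3)] satisfies [q_(k+2) = 3 q_(k+1) - q_k],
so the Hankel determinant is [\sum_(k <= n+1) (k + 1) q_k].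
Since [\sum_k q_k x^k = 1 / (1 - 3x + x^2)], the generating function of these
sums is [(1 + x) / (1 - 3x + x^2)^2], and the square of [1 - 3x + x^2] is the
quartic of the theorem.  The last step is checked on coefficients: a closed form
of the sum ([sum_tridiag3]) satisfies the recurrence of order 4 given by the
quartic, with the right initial values. *)

(** * Tridiagonal determinants and a Christoffel-Darboux sum *)

Definition tridiag (R : pzRingType) (a : R) (i j : nat) : R :=
  a *+ (i == j) + (i.+1 == j)%:R + (i == j.+1)%:R.

Definition tridiag_mx (R : pzRingType) (a : R) (m n : nat) : 'M[R]_(m, n) :=
  \matrix_(i < m, j < n) tridiag a i j.

Lemma tridiagC (R : pzRingType) (a : R) i j : tridiag a i j = tridiag a j i.
Proof.
by rewrite /tridiag eq_sym -addrA [_%:R + _]addrC addrA ![(_ == _.+1)]eq_sym.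
Qed.

Lemma det_tridiag0 (R : comPzRingType) (a : R) : \det (tridiag_mx a 0 0) = 1.
Proof. exact: det_mx00. Qed.

Lemma det_tridiag1 (R : comPzRingType) (a : R) : \det (tridiag_mx a 1 1) = a.
Proof. by rewrite det_mx11 mxE /tridiag /= !addr0. Qed.

(** The recurrence of the (rescaled) Chebyshev polynomials of the second kind:
expand along the first row, then the second minor along its first column. *)
Lemma det_tridiagSS (R : comPzRingType) (a : R) n :
  \det (tridiag_mx a n.+2 n.+2) =
  a * \det (tridiag_mx a n.+1 n.+1) - \det (tridiag_mx a n n).
Proof.
rewrite (expand_det_row _ ord0) !big_ord_recl big1 => [|j _]; last first.
  by rewrite !mxE /tridiag /= !addr0 mul0r.
rewrite addr0 !mxE /tridiag /= !addr0 add0r mul1r; congr (_ * _ + _).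
  rewrite /cofactor expr0 mul1r; congr (\det _).
  by apply/matrixP => i j; rewrite !mxE.
rewrite /cofactor /= expr1 mulN1r; congr (- _).
rewrite (expand_det_col _ ord0) big_ord_recl big1 => [|j _]; last first.
  by rewrite !mxE /tridiag /= !addr0 mul0r.
rewrite addr0 !mxE /tridiag /= !add0r mul1r /cofactor expr0 mul1r.
congr (\det _).
by apply/matrixP => i j; rewrite !mxE.
Qed.

Lemma det_tridiag2 (n : nat) : \det (tridiag_mx (2 : int) n n) = n.+1%:Z.
Proof.
elim/ltn_ind: n => [[|[|n]]] IHn; first exact: det_tridiag0.
  exact: det_tridiag1.
rewrite det_tridiagSS !IHn //; lia.
Qed.

(** The cofactors along the last row do not see the entries of that row. *)
Lemma det_add_corner (R : comPzRingType) n (M : 'M[R]_n.+1) :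
  \det (M + delta_mx ord_max ord_max) =
  \det M + \det (row' ord_max (col' ord_max M)).
Proof.
set E := delta_mx _ _.
have cofE j : cofactor (M + E) ord_max j = cofactor M ord_max j.
  congr (_ * \det _); apply/matrixP => i k.
  by rewrite !mxE eq_sym (negPf (neq_lift _ _)) addr0.
rewrite (expand_det_row (M + E) ord_max) (expand_det_row M ord_max).
under eq_bigr => j _ do rewrite cofE mxE mulrDl.
rewrite big_split /=; congr (_ + _).
rewrite (bigD1 ord_max) //= big1 ?addr0 => [|j jmax].
  by rewrite mxE !eqxx mul1r /cofactor -signr_odd addnn odd_double mul1r.
by rewrite mxE eqxx (negPf jmax) mul0r.
Qed.

(** The extra column of the two factors is zero except for a final 1, so it
contributes exactly the corner matrix of [det_add_corner]; deleting the last row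
and column of the square truncations leaves the product one size down. *)
Lemma det_tridiag_mul (R : comPzRingType) (a b : R) n :
  \det (tridiag_mx a n n.+1 *m (tridiag_mx b n n.+1)^T) =
  \sum_(k < n.+1) \det (tridiag_mx a k k) * \det (tridiag_mx b k k).
Proof.
elim: n => [|n IHn]; first by rewrite big_ord1 !det_mx00 mulr1.
rewrite big_ord_recr /= -IHn addrC -[X in _ * X]det_tr -det_mulmx.
have -> : tridiag_mx a n.+1 n.+2 *m (tridiag_mx b n.+1 n.+2)^T =
  tridiag_mx a n.+1 n.+1 *m (tridiag_mx b n.+1 n.+1)^T +
  delta_mx ord_max ord_max.
  apply/matrixP => i j; rewrite !mxE big_ord_recr /=; congr (_ + _).
    by apply: eq_bigr => k _; rewrite !mxE.
  have lastE c (k : 'I_n.+1) : tridiag c k n.+1 = (k == ord_max)%:R.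
    rewrite /tridiag (ltn_eqF (ltn_ord k)) add0r eqSS.
    by rewrite [k == n.+2 :> nat]ltn_eqF ?addr0 // ltnW // ltnS.
  by rewrite !mxE !lastE -natrM mulnb.
rewrite det_add_corner; congr (_ + \det _).
apply/matrixP => i j; rewrite !mxE; apply: eq_bigr => k _.
by rewrite !mxE !lift_max.
Qed.

(** * Ballot numbers and Catalan numbers *)

(** By the reflection principle, this counts the walks of [2 * n] steps +1 or -1
that start at 0, end at [2 * k] and stay above -2.  In pairs of steps they become the
walks governed by the matrix with 2 on the diagonal and 1 next to it. *)
Definition ballot (n k : nat) : int :=
  'C(2 * n, n + k)%:Z - 'C(2 * n, n + k + 2)%:Z.

Lemma ballot_small n k : (n < k)%N -> ballot n k = 0.
Proof. by move=> lt_nk; rewrite /ballot !bin_small //; lia. Qed.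

Lemma ballot_diag n : ballot n n = 1.
Proof. by rewrite /ballot mul2n -addnn binn bin_small //; lia. Qed.

(** Pascal's rule twice, folded by the symmetry of the row [2 * n]; it replaces
the generic recurrence at the boundary, where [n - 1] would occur. *)
Lemma bin_centralS n :
  'C(2 * n.+1, n.+1) = (2 * ('C(2 * n, n) + 'C(2 * n, n.+1)))%N.
Proof.
case: n => [|n]; first by [].
have symE : 'C(2 * n.+1, n) = 'C(2 * n.+1, n.+2).
  rewrite -[RHS]bin_sub; last by lia.
  by congr 'C(_, _); lia.
have -> : (2 * n.+2 = (2 * n.+1).+2)%N by lia.
move: (2 * n.+1)%N symE => m symE.
rewrite !binS symE; lia.
Qed.

(** All the binomial coefficients involved are rational multiples of the central
one. *)
Lemma ballot_catalan n : ballot n 0 = (catalan n.+1)%:Z.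
Proof.
rewrite /ballot !addn0 addn2.
have := mul_bin_left (2 * n) n; have := mul_bin_left (2 * n) n.+1.
have := catalanE n.+1; rewrite bin_centralS.
have -> : (2 * n - n = n)%N by lia.
case: n => [|n]; first by rewrite !bin0n; lia.
have -> : (2 * n.+1 - n.+2 = n)%N by lia.
move: 'C(_, n.+1) 'C(_, n.+2) 'C(_, n.+3) (catalan _) => x y z c; nia.
Qed.

Lemma ballotS0 n : ballot n.+1 0 = 2 * ballot n 0 + ballot n 1.
Proof.
rewrite /ballot !addn0 bin_centralS !addn2 addn1.
have -> : (2 * n.+1 = (2 * n).+2)%N by lia.
rewrite !binS; lia.
Qed.

Lemma ballotSS n k :
  ballot n.+1 k.+1 = ballot n k + 2 * ballot n k.+1 + ballot n k.+2.
Proof.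
rewrite /ballot.
have -> : (2 * n.+1 = (2 * n).+2)%N by lia.
have -> : (n.+1 + k.+1 = (n + k).+2)%N by lia.
have -> : (n + k.+1 = (n + k).+1)%N by lia.
have -> : (n + k.+2 = (n + k).+2)%N by lia.
rewrite !addn2 !binS; lia.
Qed.

Lemma big_ord_extend (R : nmodType) (f : nat -> R) m n :
  (m <= n)%N -> (forall k, (m <= k)%N -> f k = 0) ->
  \sum_(k < n) f k = \sum_(k < m) f k.
Proof.
move=> /subnKC <- f0; rewrite big_split_ord /=.
rewrite [X in _ + X]big1 ?addr0 // => k _.
by rewrite f0 // leq_addr.
Qed.

Lemma sum_delta (f : nat -> int) m n :
  ((n <= m)%N -> f m = 0) -> \sum_(k < n) f k * (k == m :> nat)%:R = f m.
Proof.
move=> f0; have [lt_mn|le_nm] := ltnP m n.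
  rewrite (bigD1 (Ordinal lt_mn)) //= eqxx mulr1 big1 ?addr0 // => k.
  by rewrite -val_eqE => /negPf ->; rewrite mulr0.
rewrite f0 // big1 // => k _.
by rewrite ltn_eqF ?mulr0 // (leq_trans (ltn_ord k)).
Qed.

(** One more step of the walk.  The truncation to [l < N] is harmless because a
walk of length [i] does not go beyond [i]. *)
Lemma sum_ballot_tridiag (a : int) N i k : (i < N)%N ->
  \sum_(l < N) ballot i l * tridiag a l k =
  ballot i.+1 k + (a - 2) * ballot i k.
Proof.
move=> lt_iN.
have sumE m : \sum_(l < N) ballot i l * (l == m :> nat)%:R = ballot i m.
  by apply: sum_delta => le_Nm; rewrite ballot_small // (leq_trans lt_iN).
under eq_bigr do rewrite /tridiag -[a *+ _]mulr_natr mulrDr mulrDr mulrCA.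
rewrite !big_split /= -mulr_sumr !sumE.
case: k => [|k].
  rewrite big1 => [|l _]; last by rewrite mulr0.
  by rewrite ballotS0; ring.
under eq_bigr do rewrite eqSS.
by rewrite sumE ballotSS; ring.
Qed.

(** The sum depends only on [i + j]: the tridiagonal matrix is symmetric, so one
step of the walk can be moved from the left factor to the right one. *)
Lemma sum_ballot_mul N i j : (i < N)%N ->
  \sum_(k < N) ballot i k * ballot j k = (catalan (i + j).+1)%:Z.
Proof.
move=> lt_iN; rewrite -ballot_catalan.
(* Moving steps to the right needs room for walks of length i + j. *)
rewrite -(@big_ord_extend _ (fun k => ballot i k * ballot j k) N (N + j));
  first last.
- by move=> k le_Nk; rewrite ballot_small ?mul0r // (leq_trans lt_iN).
- exact: leq_addr.
have {lt_iN} : (i + j < N + j)%N by rewrite ltn_add2r.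
move: (N + j)%N => {}N; elim: i j => [|i IHi] j lt_ijN.
  have ballot0 k : ballot 0 k = (k == 0)%:R.
    by case: k => [|k] //; rewrite ballot_small.
  under eq_bigr do rewrite mulrC ballot0.
  by rewrite (@sum_delta (ballot j)) // leqNgt (leq_trans _ lt_ijN).
rewrite addSnnS -IHi -?addSnnS //.
have lt_iN : (i < N)%N by lia.
have lt_jN : (j < N)%N by lia.
have stepE m k : (m < N)%N ->
    ballot m.+1 k = \sum_(l < N) ballot m l * tridiag 2 l k.
  by move=> lt_mN; rewrite sum_ballot_tridiag // subrr mul0r addr0.
under eq_bigr do rewrite stepE // mulr_suml.
rewrite exchange_big; apply: eq_bigr => l _ /=.
rewrite stepE // mulr_sumr; apply: eq_bigr => k _.
by rewrite tridiagC -mulrA [_ * ballot j k]mulrC.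
Qed.

(** * The Hankel determinant and its generating function *)

Lemma hankel_sum_tridiag n :
  hankel_transform (fun k => (catalan (k + 2) + catalan (k + 3))%:Z) n =
  \sum_(k < n.+2) k.+1%:Z * \det (tridiag_mx (3 : int) k k).
Proof.
under eq_bigr do rewrite -det_tridiag2.
rewrite -det_tridiag_mul /hankel_transform.
pose L : 'M[int]_n.+1 := \matrix_(i, j) ballot i j.
have detL : \det L = 1.
  rewrite det_trig; last first.
    by apply/is_trig_mxP => i j lt_ij; rewrite mxE ballot_small.
  by apply: big1 => i _; rewrite mxE ballot_diag.
have mulLE a (i : 'I_n.+1) (k : 'I_n.+2) :
    (L *m tridiag_mx a n.+1 n.+2) i k = ballot i.+1 k + (a - 2) * ballot i k.
  rewrite mxE -(sum_ballot_tridiag _ _ (ltn_ord i)).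
  by apply: eq_bigr => l _; rewrite !mxE.
set A := _ *m _^T.
have -> : \det A = \det (L *m A *m L^T).
  by rewrite !det_mulmx det_tr detL mulr1 mul1r.
congr (\det _); rewrite /A mulmxA -mulmxA -trmx_mul.
apply/matrixP => i j; rewrite mxE [RHS]mxE.
under eq_bigr do rewrite [_^T _ _]mxE !mulLE subrr mul0r addr0 mulrDr.
rewrite big_split /=.
under [X in _ = _ + X]eq_bigr do rewrite mulrCA.
rewrite -mulr_sumr !sum_ballot_mul ?ltnS ?leq_ord //.
rewrite addn2 addn3 addnS !addSn.
rewrite PoszD; ring.
Qed.

(** With [q k] the Fibonacci number of index [2 * k + 2], the difference
[q n.+1 - q n] is the one of index [2 * n + 3]: this is summation by parts. *)
Lemma sum_tridiag3 n (q := fun k => \det (tridiag_mx (3 : int) k k)) :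
  \sum_(k < n.+1) k.+1%:Z * q k = n.+1%:Z * (q n.+1 - q n) - q n.
Proof.
elim: n => [|n IHn].
  by rewrite big_ord1 /q det_tridiag0 det_tridiag1.
rewrite big_ord_recr /= IHn /q det_tridiagSS intS; ring.
Qed.

(** The recurrence and initial values that express [g * g^-1 = 1]
coefficientwise. *)
Lemma fps_inv_rec (u := fps_inv (fps_of_poly
    (1 - 6 *: 'X + 11 *: 'X^2 - 6 *: 'X^3 + 'X^4 : {poly int}))) :
  [/\ u 0%N = 1, u 1%N = 6, u 2%N = 25, u 3%N = 90 &
    forall n, u n.+4 = 6 * u n.+3 - 11 * u n.+2 + 6 * u n.+1 - u n].
Proof.
set g := fps_of_poly _ in u *.
have gE i : g i = [:: 1; -6; 11; -6; 1]`_i.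
  rewrite /g /fps_of_poly !(coefD, coefB, coefN, coefZ, coefX, coefXn, coef1).
  by case: i => [|[|[|[|[|i]]]]]; rewrite //= nth_nil.
have gu n : \sum_(i < n.+1) g i * u (n - i)%N = (n == 0)%:R.
  by apply: fps_mulV; rewrite gE unitr1.
have urec n :
    u n.+4 = 6 * u n.+3 - 11 * u n.+2 + 6 * u n.+1 - u n.
  have := gu n.+4; rewrite 5!big_ord_recl big1 => [|i _]; last first.
    by rewrite gE /= nth_nil mul0r.
  rewrite !gE /= !subSS !subn0; lia.
have := gu 0%N; have := gu 1%N; have := gu 2%N; have := gu 3%N.
rewrite !big_ord_recl !big_ord0 !gE /= !subSS !subn0 => *; split=> //; lia.
Qed.

Theorem corollary14 (n : nat) :
  hankel_transform (fun k : nat => (catalan (k + 2) + catalan (k + 3))%:Z) n =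
  coef_fps n.+1
    (fps_div
       (fps_of_poly (1 + 'X : {poly int}))
       (fps_of_poly (1 - 6 *: 'X + 11 *: 'X^2 - 6 *: 'X^3 + 'X^4 : {poly int}))).
Proof.
rewrite hankel_sum_tridiag sum_tridiag3.
rewrite /coef_fps /fps_div /fps_mul 2!big_ord_recl big1 => [|i _]; last first.
  by rewrite /fps_of_poly coefD coef1 coefX /= add0r mul0r.
rewrite /fps_of_poly !coefD !coef1 !coefX /= !addr0 add0r !mul1r subSS !subn0.
have [] := fps_inv_rec; move: (fps_inv _) => u u0 u1 u2 u3 urec.
pose q k : int := \det (tridiag_mx 3 k k).
have qSS k : q k.+2 = 3 * q k.+1 - q k by apply: det_tridiagSS.
have [q0 q1] : q 0%N = 1 /\ q 1%N = 3 by rewrite /q det_tridiag0 det_tridiag1.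
rewrite -!/(q _).
pose h m : int := m.+2%:Z * (q m.+2 - q m.+1) - q m.+1.
have hrec m : h m.+4 = 6 * h m.+3 - 11 * h m.+2 + 6 * h m.+1 - h m.
  by rewrite /h !qSS; ring.
rewrite -/(h n); elim/ltn_ind: n => [[|[|[|[|n]]]]] IHn;
  try by rewrite /h !(qSS, q1, q0, urec, u3, u2, u1, u0).
rewrite hrec !IHn; try lia.
rewrite (urec n.+1) (urec n); ring.
Qed.
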